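(* Let $P\subset\mathbb{R}^D$ be an $(\epsilon_1,\epsilon_2)$-significant instance of $k$-center clustering with $z$ outliers, $|P|=n$, and let $\eta,\delta\in(0,1)$. Consider the following algorithm: (1) sample a set $S$ of $\frac{3k}{\delta^2\epsilon_1}\log\frac{2k}{\eta}$ points uniformly at random from $P$; (2) let $z'=\frac{1}{\eta}\frac{\epsilon_2}{k}|S|$ and solve $k$-center clustering with $z'$ outliers on $S$ using any $c$-approximation algorithm with $c\ge 1$; output the set $H$ of $k$ returned centers. If $\frac{\epsilon_1}{\epsilon_2}>\frac{1}{\eta(1-\delta)}$, then with probability at least $(1-\eta)^2$, $\Delta^{-z}_{\infty}(P,H)\le(c+2)r_{opt}$.
   Context: For a finite $H\subset\mathbb{R}^D$ and a point $p$, $dist(p,H)=\min_{q\in H}\|p-q\|$. For a finite point set $Q$ and integer $0<w<|Q|$, $\Delta^{-w}_{\infty}(Q,H)=\min\{\max_{p\in Q'}dist(p,H): Q'\subset Q, |Q'|=|Q|-w\}$. The $k$-center clustering with $w$ outliers problem on $Q$ asks for $k$ centers $C\subset\mathbb{R}^D$ minimizing $\Delta^{-w}_{\infty}(Q,C)$; a $c$-approximation algorithm returns $k$ centers whose value is at most $c$ times the optimum. $r_{opt}$ is the optimal value for $P$ with $z$ outliers. $P_{opt}\subset P$ with $|P_{opt}|=n-z$ denotes the set of inliers of an optimal solution for $P$, and $C^*_1,\dots,C^*_k$ the optimal clusters forming $P_{opt}$. The instance is $(\epsilon_1,\epsilon_2)$-significant ($\epsilon_1,\epsilon_2>0$) if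 $\min_j|C^*_j|\ge\frac{\epsilon_1}{k}n$ and $z=\frac{\epsilon_2}{k}n$. Sampling uniformly at random means each sample point is drawn independently and uniformly from $P$ ($S$ is regarded as a multiset). *)

(* Defs.v *)
From mathcomp Require Import all_boot all_order all_algebra.
From mathcomp Require Import classical_sets reals exp.
Set Implicit Arguments. Unset Strict Implicit. Unset Printing Implicit Defensive.
Import Order.TTheory GRing.Theory Num.Theory.
Local Open Scope ring_scope.
Local Open Scope classical_set_scope.

Section Defs.
Variables (R : realType) (D : nat).

Definition edist (p q : 'rV[R]_D) : R :=
  Num.sqrt (\sum_(i < D) (p ord0 i - q ord0 i) ^+ 2).

Definition distC (k : nat) (p : 'rV[R]_D) (H : 'I_k -> 'rV[R]_D) : R :=
  inf [set edist p (H i) | i in [set: 'I_k]].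

(* Delta^{-w}_infty(Q,H) for a (multi)set Q indexed by 'I_m:
   min over sub-multisets Q' of size m - w of max_{p in Q'} dist(p,H). *)
Definition Delta (m : nat) (Q : 'I_m -> 'rV[R]_D) (w : nat) (k : nat)
    (H : 'I_k -> 'rV[R]_D) : R :=
  inf [set (\big[Num.max/0]_(i in A) distC (Q i) H)
       | A in [set A : {set 'I_m} | #|A| = (m - w)%N]].

Definition kc_opt (m : nat) (Q : 'I_m -> 'rV[R]_D) (w k : nat) : R :=
  inf [set Delta Q w H | H in [set: 'I_k -> 'rV[R]_D]].

Definition significant (n : nat) (P : 'I_n -> 'rV[R]_D) (k z : nat)
    (e1 e2 : R) : Prop :=
  z%:R = e2 / k%:R * n%:R /\
  exists (Copt : 'I_k -> 'rV[R]_D) (Popt : {set 'I_n}) (f : 'I_n -> 'I_k),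
    [/\ Delta P z Copt = kc_opt P z k,
        #|Popt| = (n - z)%N,
        (forall i, i \in Popt ->
           edist (P i) (Copt (f i)) = distC (P i) Copt /\
           distC (P i) Copt <= kc_opt P z k) &
        (forall j : 'I_k, e1 / k%:R * n%:R <= #|[set i in Popt | f i == j]|%:R)].

End Defs.

(* Main.v *)
(** Call a sample clean if it contains at most [z'] outliers, and full if every
    optimal cluster contributes more than [z'] sample points.  On a clean and
    full sample the bound holds deterministically.  A sample is clean with
    probability at least [1 - eta] by Markov's inequality, and full with
    probability at least [1 - eta / 2] by a Chernoff bound on each cluster.
    These events are not independent, and a union bound is too weak for
    [eta] close to [1]; but replacing an outlier by an inlier favours both, so
    they are positively correlated and their probabilities may be multiplied. *)

Require Import Defs.
From mathcomp Require Import all_boot all_order all_algebra.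
From mathcomp Require Import classical_sets reals exp.
From mathcomp Require Import boolp sequences zify ring lra.
Set Implicit Arguments.
Unset Strict Implicit.
Unset Printing Implicit Defensive.
Import Order.TTheory GRing.Theory Num.Theory.
Local Open Scope ring_scope.

(** * Expectations over independent uniform draws *)

Section Sampling.
Variables (R : realType) (T : finType).
Implicit Types (F G : seq T -> R) (C : pred T) (s : seq T).

(** Expectation of [F] over [m] independent uniform draws from [T]. Recursion on the first draw
    encodes independence and allows induction on [m]. *)
Fixpoint Esample (m : nat) (F : seq T -> R) : R :=
  if m is m'.+1 then
    (\sum_(x : T) Esample m' (fun s => F (x :: s))) / #|T|%:R
  else F [::].

Lemma eq_Esample m F G :
  (forall s, size s = m -> F s = G s) -> Esample m F = Esample m G.
Proof.
elim: m F G => [|m IH] F G FG /=; first exact: FG.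
congr (_ / _); apply: eq_bigr => x _.
by apply: IH => s sm; apply: FG; rewrite /= sm.
Qed.

Lemma le_Esample m F G :
  (forall s, size s = m -> F s <= G s) -> Esample m F <= Esample m G.
Proof.
elim: m F G => [|m IH] F G FG /=; first exact: FG.
rewrite ler_wpM2r ?invr_ge0 ?ler0n //; apply: ler_sum => x _.
by apply: IH => s sm; apply: FG; rewrite /= sm.
Qed.

Lemma EsampleD m F G :
  Esample m (fun s => F s + G s) = Esample m F + Esample m G.
Proof.
elim: m F G => [|m IH] F G //=.
rewrite -mulrDl -big_split /=; congr (_ / _).
by apply: eq_bigr => x _; rewrite IH.
Qed.

Lemma EsampleZ m (a : R) F : Esample m (fun s => a * F s) = a * Esample m F.
Proof.
elim: m F => [|m IH] F //=.
rewrite mulrA mulr_sumr; congr (_ / _).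
by apply: eq_bigr => x _; rewrite IH.
Qed.

Lemma Esample_sum m (I : finType) (F : I -> seq T -> R) :
  Esample m (fun s => \sum_i F i s) = \sum_i Esample m (F i).
Proof.
elim: m F => [|m IH] F //=.
by under eq_bigr do rewrite IH; rewrite exchange_big mulr_suml.
Qed.

(** Links the recursive expectation to the count of sample functions by which the theorem states its
    probability. *)
Lemma Esample_ffun m F :
  Esample m F =
  (\sum_(f : {ffun 'I_m -> T}) F (codom f)) / (#|T| ^ m)%:R.
Proof.
have codomE p (f : {ffun 'I_p -> T}) : codom f = [seq f i | i <- enum 'I_p].
  by rewrite codomE.
elim: m F => [|m IH] F /=.
  rewrite expn0 divr1 (eq_bigr (fun=> F [::])).
    by rewrite sumr_const card_ffun card_ord expn0.
  by move=> f _; rewrite codomE enum_ord0.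
(* [h] and [g] are inverse bijections between a sample and the pair of its first draw and the
   rest. *)
pose h (p : T * {ffun 'I_m -> T}) : {ffun 'I_m.+1 -> T} :=
  [ffun i => if unlift ord0 i is Some j then p.2 j else p.1].
pose g (f : {ffun 'I_m.+1 -> T}) : T * {ffun 'I_m -> T} :=
  (f ord0, [ffun j => f (lift ord0 j)]).
rewrite (reindex h) /=; last first.
  exists g => [[x f] _|f _].
    rewrite /g ffunE unlift_none; congr (_, _).
    by apply/ffunP => j; rewrite !ffunE liftK.
  by apply/ffunP => i; rewrite ffunE; case: unliftP => [j|] -> //; rewrite ffunE.
rewrite -(pair_bigA _ (fun x f => F (codom (h (x, f))))) /=.
rewrite expnS natrM invfM [_^-1 * _]mulrC mulrA; congr (_ / _).
rewrite mulr_suml; apply: eq_bigr => x _; rewrite IH; congr (_ / _).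
apply: eq_bigr => f _; congr F.
rewrite !codomE enum_ordSl /= ffunE unlift_none /=; congr cons.
by rewrite -map_comp; apply: eq_map => j; rewrite /= ffunE liftK.
Qed.

Hypothesis T_gt0 : (0 < #|T|)%N.

Let T_gt0R : (0 : R) < #|T|%:R. Proof. by rewrite ltr0n. Qed.

Lemma Esample_cst m (a : R) : Esample m (fun=> a) = a.
Proof.
elim: m => [|m IH] //=.
by rewrite sumr_const IH -[a *+ _]mulr_natr mulfK // gt_eqF.
Qed.

(** Chebyshev's sum inequality for similarly ordered functions: the nonnegative double sum of
    [(f x - f y) * (g x - g y)] is twice the difference of the two sides. *)
Lemma chebyshev_sum (f g : T -> R) :
  (forall x y, 0 <= (f x - f y) * (g x - g y)) ->
  (\sum_x f x) * (\sum_x g x) <= #|T|%:R * \sum_x f x * g x.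
Proof.
move=> fg; have : 0 <= \sum_x \sum_y (f x - f y) * (g x - g y).
  by apply: sumr_ge0 => x _; apply: sumr_ge0 => y _.
have -> : \sum_x \sum_y (f x - f y) * (g x - g y) =
    2 * (#|T|%:R * (\sum_x f x * g x) - (\sum_x f x) * (\sum_x g x)).
  under eq_bigr => x _.
    rewrite (eq_bigr (fun y => f x * g x - f x * g y - g x * f y + f y * g y));
      last by move=> y _; ring.
    rewrite big_split /= sumrB sumrB sumr_const -!mulr_sumr -[_ *+ #|_|]mulr_natl.
    over.
  rewrite big_split /= !sumrB -mulr_sumr -!mulr_suml sumr_const.
  by rewrite -[_ *+ #|_|]mulr_natl; ring.
by rewrite pmulr_rge0 // subr_ge0.
Qed.

(* [F] may tell the good points apart; [G] only sees whether each point
   is bad.  A draw that replaces a good point by a bad one lowers both, so the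
   two are positively correlated although no total order underlies [F]. *)
Lemma Esample_association (bad : pred T) m F G :
  (forall s x y t, ~~ bad x -> bad y -> F (s ++ y :: t) <= F (s ++ x :: t)) ->
  (forall s x y t, (bad x ==> bad y) -> G (s ++ y :: t) <= G (s ++ x :: t)) ->
  Esample m F * Esample m G <= Esample m (fun s => F s * G s).
Proof.
elim: m F G => [|m IH] F G mF mG //=.
pose f x := Esample m (fun s => F (x :: s)).
pose g x := Esample m (fun s => G (x :: s)).
have fg x : f x * g x <= Esample m (fun s => F (x :: s) * G (x :: s)).
  by apply: IH => s y y' t *; [apply: (mF (x :: s))|apply: (mG (x :: s))].
have mf x y : ~~ bad x -> bad y -> f y <= f x.
  by move=> bx by_; apply: le_Esample => s _; apply: (mF [::]).
have mg x y : bad x ==> bad y -> g y <= g x.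
  by move=> bxy; apply: le_Esample => s _; apply: (mG [::]).
rewrite mulrA ler_wpM2r ?invr_ge0 ?(ltW T_gt0R) // mulrAC ler_pdivrMr //.
apply: (@le_trans _ _ (#|T|%:R * \sum_x f x * g x)); last first.
  by rewrite mulrC ler_wpM2r ?(ltW T_gt0R) // ler_sum.
(* If [x] and [y] are both good or both bad, then [g x = g y]; otherwise neither [f] nor [g] is
   larger at the bad point. *)
apply: (@chebyshev_sum f g) => x y.
case bx : (bad x); case by_ : (bad y).
- have -> : g x = g y by apply/eqP; rewrite eq_le !mg ?bx ?by_.
  by rewrite subrr mulr0.
- by rewrite mulr_le0 // subr_le0 ?mf ?mg ?bx ?by_.
- by rewrite mulr_ge0 // subr_ge0 ?mf ?mg ?bx ?by_.
- have -> : g x = g y by apply/eqP; rewrite eq_le !mg ?bx ?by_.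
  by rewrite subrr mulr0.
Qed.

Lemma Esample_count m C :
  Esample m (fun s => (count C s)%:R) = m%:R * (#|C|%:R / #|T|%:R).
Proof.
elim: m => [|m IH] /=; first by rewrite mul0r.
under eq_bigr => x _.
  rewrite (eq_Esample (G := fun s => (C x)%:R + (count C s)%:R)); last first.
    by move=> s _; rewrite natrD.
  rewrite EsampleD Esample_cst IH; over.
rewrite big_split /= sumr_const -natr_sum -big_mkcond /= sum1_card.
rewrite -[_ *+ #|_|]mulr_natl -natr1.
by field; rewrite gt_eqF.
Qed.

(** Generating function of a binomial variable: each draw contributes an independent factor of mean
    [1 - p * (1 - a)], where [p] is the density of [C]. *)
Lemma Esample_expr_count m C (a : R) :
  Esample m (fun s => a ^+ count C s) =
  (1 - #|C|%:R / #|T|%:R * (1 - a)) ^+ m.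
Proof.
elim: m => [|m IH] //=.
under eq_bigr => x _.
  rewrite (eq_Esample (G := fun s => a ^+ C x * a ^+ count C s)); last first.
    by move=> s _; rewrite exprD.
  rewrite EsampleZ IH; over.
rewrite -mulr_suml exprS mulrAC; congr (_ * _).
rewrite (eq_bigr (fun x => 1 - (C x)%:R * (1 - a))); last first.
  by move=> x _; case: (C x); rewrite /= ?mul1r ?mul0r ?subKr ?subr0.
rewrite sumrB sumr_const -mulr_suml -natr_sum -big_mkcond /= sum1_card.
by field; rewrite gt_eqF.
Qed.

(** Markov's inequality at the integer threshold [w.+1], which later absorbs the rounding down in
    [z']. *)
Lemma Esample_markov m C w :
  Esample m (fun s => (w < count C s)%N%:R) <=
  m%:R * (#|C|%:R / #|T|%:R) / w.+1%:R.
Proof.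
rewrite -Esample_count mulrC -EsampleZ; apply: le_Esample => s _.
rewrite mulrC ler_pdivlMr ?ltr0n // -natrM ler_nat.
by case: ltnP => // wc; rewrite mul1n.
Qed.

(** Since [expR x >= (1 + x / 2) ^+ 2], it suffices that this square times the quadratic is at least
    1. The coefficient 3/4 cancels the second-order term and produces the 3 in the Chernoff
    exponent. *)
Lemma expRN_le_quadratic (x : R) : 0 <= x -> expR (- x) <= 1 - x + 3 / 4 * x ^+ 2.
Proof.
move=> x0; rewrite expRN.
have e2 : (1 + x / 2) ^+ 2 <= expR x.
  rewrite [in leRHS](_ : x = x / 2 + x / 2); last by field.
  rewrite expRD -expr2 ler_sqr ?nnegrE ?expR_ge0 ?expR_ge1Dx //.
  by rewrite addr_ge0 // divr_ge0.
have s0 : 0 < (1 + x / 2) ^+ 2 by rewrite exprn_gt0 // ltr_wpDr // divr_ge0.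
apply: (@le_trans _ _ (((1 + x / 2) ^+ 2)^-1)).
  by rewrite lef_pV2 ?posrE ?expR_gt0.
rewrite -[leLHS]mul1r ler_pdivrMr // -subr_ge0.
rewrite (_ : _ - _ = x ^+ 3 * (2^-1 + 3 / 16 * x)); last by field.
by rewrite mulr_ge0 ?exprn_ge0 //; lra.
Qed.

(* [2 * delta / 3] maximizes the exponent [delta * l - 3 / 4 * l ^+ 2] that
   [expRN_le_quadratic] gives for the exponential Markov inequality. *)
Lemma Esample_chernoff m C w (delta : R) :
  let mu := m%:R * (#|C|%:R / #|T|%:R) in
  0 < delta -> w%:R <= (1 - delta) * mu ->
  Esample m (fun s => (count C s <= w)%N%:R) <= expR (- (delta ^+ 2 * mu / 3)).
Proof.
move=> mu d0 wmu; pose l := 2 * delta / 3.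
have l0 : 0 <= l by rewrite /l divr_ge0 // mulr_ge0 // ltW.
set p : R := #|C|%:R / #|T|%:R in mu wmu *.
have p0 : 0 <= p by rewrite divr_ge0.
have p1 : p <= 1 by rewrite ler_pdivrMr // mul1r ler_nat max_card.
pose a := expR (- l).
have a1 : a <= 1 by rewrite /a -expR0 ler_expR oppr_le0.
(* Exponential Markov: the indicator is at most [expR (l * (w - count C s))]. *)
apply: (@le_trans _ _ (expR (l * w%:R) * (1 - p * (1 - a)) ^+ m)).
  rewrite /p -Esample_expr_count -EsampleZ; apply: le_Esample => s _.
  rewrite /a -expRM_natl -expRD.
  case: leqP => cw; last exact: expR_ge0.
  rewrite -[leLHS]expR0 ler_expR mulrN -mulNr [l * _]mulrC -mulrDl.
  by rewrite mulr_ge0 // subr_ge0 ler_nat.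
apply: (@le_trans _ _ (expR (l * w%:R) * expR (- (p * (1 - a))) ^+ m)).
  rewrite ler_wpM2l ?expR_ge0 // lerXn2r ?nnegrE ?expR_ge0 //.
    by rewrite subr_ge0 mulr_ile1 ?subr_ge0 // gerBl expR_ge0.
  exact: expR_ge1Dx.
rewrite -expRM_natl -expRD ler_expR.
have aq : a <= 1 - l + 3 / 4 * l ^+ 2 by apply: expRN_le_quadratic.
have mu0 : 0 <= mu by rewrite mulr_ge0.
have h1 : l * w%:R <= l * ((1 - delta) * mu) by rewrite ler_wpM2l.
have h2 : mu * (l - 3 / 4 * l ^+ 2) <= mu * (1 - a) by rewrite ler_wpM2l //; lra.
rewrite mulrN mulrA -/mu.
have : l * ((1 - delta) * mu) - mu * (l - 3 / 4 * l ^+ 2) =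
  - (delta ^+ 2 * mu / 3) by rewrite /l; field.
lra.
Qed.

End Sampling.

(** * Finite minima, subsets and counts *)

Section FiniteInf.
Variables (R : realType) (T : finType) (A : set T) (F : T -> R).

(** Lets the infima in [distC] and [Delta] be handled as minima; [x0] witnesses that the index set
    is nonempty. *)
Lemma inf_fin_attained x0 : A x0 ->
  exists x, [/\ A x, inf [set F y | y in A]%classic = F x &
                 forall y, A y -> F x <= F y].
Proof.
move=> Ax0.
have /asboolP Px0 := Ax0.
case: (@arg_minP _ _ _ x0 (fun x => `[< A x >]) F Px0) => x /asboolP Ax minx.
have min y : A y -> F x <= F y by move=> Ay; apply: minx; apply/asboolP.
exists x; split => //; apply/le_anti/andP; split.
  by apply: ge_inf; [exists (F x) => _ [y Ay <-]; apply: min|exists x].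
by apply: lb_le_inf; [exists (F x); exists x|move=> _ [y Ay <-]; apply: min].
Qed.

Lemma inf_fin_le x : A x -> inf [set F y | y in A]%classic <= F x.
Proof. by move=> Ax; have [y [_ -> ]] := inf_fin_attained Ax; apply. Qed.

End FiniteInf.

Lemma exists_subset_card (T : finType) (B : {set T}) p : (p <= #|B|)%N ->
  exists2 A : {set T}, A \subset B & #|A| = p.
Proof.
move=> pB; have : (0 < #|[set A : {set T} | (A \subset B) && (#|A| == p)]|)%N.
  by rewrite cards_draws bin_gt0.
by case/card_gt0P => A; rewrite inE => /andP[AB /eqP Ap]; exists A.
Qed.

Lemma count_codom (T : finType) m (s : {ffun 'I_m -> T}) (B : pred T) :
  count B (codom s) = #|[set i | B (s i)]|.
Proof.
rewrite codomE count_map -size_filter cardE; congr size.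
by rewrite enumT /enum_mem; apply: eq_filter => i; rewrite -[RHS]/(i \in _) inE.
Qed.

(** * Euclidean distance and clustering cost *)

Section Clustering.
Variables (R : realType) (D : nat).
Implicit Types p q : 'rV[R]_D.

(** Lagrange's identity: the sum of all [(a i * b j - a j * b i) ^+ 2] is twice the difference of
    the two sides. *)
Lemma cauchy_schwarz_sum (a b : 'I_D -> R) :
  (\sum_i a i * b i) ^+ 2 <= (\sum_i a i ^+ 2) * (\sum_i b i ^+ 2).
Proof.
have : 0 <= \sum_i \sum_j (a i * b j - a j * b i) ^+ 2.
  by apply: sumr_ge0 => i _; apply: sumr_ge0 => j _; apply: sqr_ge0.
have -> : \sum_i \sum_j (a i * b j - a j * b i) ^+ 2 =
    2 * ((\sum_i a i ^+ 2) * (\sum_i b i ^+ 2) - (\sum_i a i * b i) ^+ 2).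
  under eq_bigr => i _.
    rewrite (eq_bigr (fun j => a i ^+ 2 * b j ^+ 2 + b i ^+ 2 * a j ^+ 2
      - 2 * (a i * b i) * (a j * b j))); last by move=> j _; ring.
    rewrite sumrB big_split /= -!mulr_sumr.
    over.
  by rewrite sumrB big_split /= -!mulr_suml -mulr_sumr; ring.
by rewrite pmulr_rge0 // subr_ge0.
Qed.

Lemma edist_ge0 p q : 0 <= edist p q.
Proof. exact: sqrtr_ge0. Qed.

Lemma edistC p q : edist p q = edist q p.
Proof. by congr Num.sqrt; apply: eq_bigr => i _; rewrite -sqrrN opprB. Qed.

Lemma edist_triangle p q o : edist p o <= edist p q + edist q o.
Proof.
rewrite -ler_sqr ?nnegrE ?addr_ge0 ?edist_ge0 // sqrrD.
pose a i := p ord0 i - q ord0 i; pose b i := q ord0 i - o ord0 i.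
have sq_ge0 (c : 'I_D -> R) : 0 <= \sum_i c i ^+ 2.
  by apply: sumr_ge0 => i _; apply: sqr_ge0.
rewrite [edist p o ^+ 2]sqr_sqrtr ?[edist p q ^+ 2]sqr_sqrtr
  ?[edist q o ^+ 2]sqr_sqrtr ?(sq_ge0 (fun i => p ord0 i - o ord0 i))
  ?(sq_ge0 a) ?(sq_ge0 b) //.
rewrite (eq_bigr (fun i => a i ^+ 2 + 2 * (a i * b i) + b i ^+ 2)); last first.
  by move=> i _; rewrite /a /b; ring.
rewrite !big_split /= -mulr_sumr lerD2r lerD2l -[leRHS]mulr_natl ler_wpM2l //.
rewrite /edist -sqrtrM ?(sq_ge0 a) //.
apply: le_trans (ler_norm _) _; rewrite -sqrtr_sqr ler_wsqrtr //.
exact: (cauchy_schwarz_sum a b).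
Qed.

Lemma distC_le k p (H : 'I_k -> 'rV[R]_D) i : distC p H <= edist p (H i).
Proof. exact: (inf_fin_le (fun i => edist p (H i)) (x := i)). Qed.

Lemma distC_attained k p (H : 'I_k -> 'rV[R]_D) : (0 < k)%N ->
  exists i, distC p H = edist p (H i).
Proof.
move=> k0; rewrite /distC.
have [i [_ -> _]] := @inf_fin_attained R _ setT (fun i => edist p (H i))
  (Ordinal k0) I.
by exists i.
Qed.

Section Delta.
Variables (m : nat) (Q : 'I_m -> 'rV[R]_D) (w k : nat).
Implicit Type H : 'I_k -> 'rV[R]_D.

Lemma Delta_le H (r : R) (A : {set 'I_m}) : #|A| = (m - w)%N -> 0 <= r ->
  (forall i, i \in A -> distC (Q i) H <= r) -> Delta Q w H <= r.
Proof.
move=> cA r0 Ar.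
apply: le_trans
  (inf_fin_le (A := fun A : {set 'I_m} => #|A| = (m - w)%N) _ cA) _ => /=.
exact: bigmax_le.
Qed.

Lemma Delta_attained H : exists2 A : {set 'I_m}, #|A| = (m - w)%N &
  Delta Q w H = \big[Num.max/0]_(i in A) distC (Q i) H.
Proof.
have [|A0 _ cA0] := @exists_subset_card _ [set: 'I_m] (m - w).
  by rewrite cardsT card_ord leq_subr.
have [A [cA DA _]] := @inf_fin_attained R _
  (fun A : {set 'I_m} => #|A| = (m - w)%N)
  (fun A => \big[Num.max/0]_(i in A) distC (Q i) H) A0 cA0.
by exists A.
Qed.

Lemma Delta_ge0 H : 0 <= Delta Q w H.
Proof. by have [A _ ->] := Delta_attained H; apply: bigmax_ge_id. Qed.

Lemma kc_opt_ge0 : 0 <= kc_opt Q w k.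
Proof.
apply: lb_le_inf; first by exists (Delta Q w (fun _ : 'I_k => 0)), (fun=> 0).
by move=> _ [H _ <-]; apply: Delta_ge0.
Qed.

(** Centers range over an infinite set, so the argument rests on the lower bound 0 instead of on
    attainment. *)
Lemma kc_opt_le H : kc_opt Q w k <= Delta Q w H.
Proof.
by apply: ge_inf; [exists 0 => _ [H' _ <-]; apply: Delta_ge0|exists H].
Qed.

End Delta.

(* A sample with at most [w] outliers costs at most [r] with the optimal
   centers, so the outliers dropped by [H] cannot exhaust a cluster that
   contains more than [w] samples; a surviving sample then links its whole
   cluster to [H] through the cluster center. *)
Lemma Delta_of_good_sample n m k z w (P : 'I_n -> 'rV[R]_D) (s : 'I_m -> 'I_n)
    (Popt : {set 'I_n}) (f : 'I_n -> 'I_k) (Copt H : 'I_k -> 'rV[R]_D) (c r : R) :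
  (0 < k)%N -> #|Popt| = (n - z)%N -> 0 <= c -> 0 <= r ->
  (forall i, i \in Popt -> edist (P i) (Copt (f i)) <= r) ->
  (#|[set i | s i \notin Popt]| <= w)%N ->
  (forall j, w < #|[set i | (s i \in Popt) && (f (s i) == j)]|)%N ->
  Delta (fun i => P (s i)) w H <= c * kc_opt (fun i => P (s i)) w k ->
  Delta P z H <= (c + 2) * r.
Proof.
move=> k0 cPopt c0 r0 Pr few many approx.
have opt_le : kc_opt (fun i => P (s i)) w k <= r.
  have [|A AB cA] := @exists_subset_card _ [set i | s i \in Popt] (m - w).
    have := cardsC [set i | s i \in Popt]; rewrite card_ord.
    rewrite (_ : ~: _ = [set i | s i \notin Popt]); first lia.
    by apply/setP => i; rewrite !inE.
  apply: le_trans (kc_opt_le _ _ Copt) _; apply: Delta_le cA r0 _ => i iA.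
  apply: le_trans (distC_le _ _ (f (s i))) _; apply: Pr.
  by move/fintype.subsetP: AB => /(_ _ iA); rewrite inE.
have [A cA DA] := Delta_attained (fun i => P (s i)) w H.
have HA i : i \in A -> distC (P (s i)) H <= c * r.
  move=> iA; apply: le_trans (le_trans approx _); last by rewrite ler_wpM2l.
  by rewrite DA; apply: (le_bigmax_cond _ (fun i => distC (P (s i)) H)).
apply: Delta_le cPopt _ _; first by rewrite mulr_ge0 // addr_ge0.
move=> x xP.
have [i iA /andP[siP /eqP fsi]] :
    exists2 i, i \in A & (s i \in Popt) && (f (s i) == f x).
  have : ~~ ([set i | (s i \in Popt) && (f (s i) == f x)] \subset ~: A).
    apply: contraL (many (f x)) => /subset_leq_card sub; rewrite -leqNgt.
    apply: leq_trans sub _; rewrite cardsCs finset.setCK card_ord cA; lia.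
  by case/fintype.subsetPn => i; rewrite !inE negbK => ? ?; exists i.
have [j Hj] := distC_attained (P (s i)) H k0.
apply: le_trans (distC_le _ _ j) _.
(* The path from [P x] through its optimal center and the surviving sample to [H j] has legs at most
   [r], [r] and [c * r]. *)
have h1 := edist_triangle (P x) (Copt (f x)) (H j).
have h2 := edist_triangle (Copt (f x)) (P (s i)) (H j).
have h3 := Pr _ xP.
have h4 := Pr _ siP; rewrite fsi edistC in h4.
have h5 := HA _ iA; rewrite Hj in h5.
lra.
Qed.

End Clustering.

(** * Success probability of the sampling algorithm *)

Unset Implicit Arguments.

Theorem theorem2 (R : realType) (D n k z m z' : nat)
    (P : 'I_n -> 'rV[R]_D) (e1 e2 eta delta c : R)
    (alg : ('I_m -> 'rV[R]_D) -> 'I_k -> 'rV[R]_D) :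
  injective P -> (0 < k)%N -> (0 < z < n)%N ->
  0 < e1 -> 0 < e2 -> significant P k z e1 e2 ->
  0 < eta < 1 -> 0 < delta < 1 ->
  (* |S| = m = ceil (3k/(delta^2 eps1) * log (2k/eta)) *)
  (let X := 3 * k%:R / (delta ^+ 2 * e1) * ln (2 * k%:R / eta) in
     X <= m%:R < X + 1) ->
  (* z' = floor (1/eta * eps2/k * |S|) *)
  (let Y := 1 / eta * (e2 / k%:R) * m%:R in z'%:R <= Y < z'%:R + 1) ->
  1 <= c ->
  (* alg is a c-approximation for k-center with z' outliers on samples *)
  (forall S : 'I_m -> 'rV[R]_D, Delta S z' (alg S) <= c * kc_opt S z' k) ->
  e1 / e2 > 1 / (eta * (1 - delta)) ->
  (1 - eta) ^+ 2 <=
    #|[set s : {ffun 'I_m -> 'I_n}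
        | Delta P z (alg (fun i => P (s i))) <= (c + 2) * kc_opt P z k]|%:R
    / (n ^ m)%:R.
Proof.
move=> _ k0 /andP[z0 zn] e1_0 e2_0 [zE [Copt [Popt [f [_ cPopt Pr big]]]]].
move=> /andP[eta0 eta1] /andP[d0 d1] /= /andP[Xm _] /andP[zY Yz] c1 approx ratio.
have n0 : (0 < #|'I_n|)%N by rewrite card_ord (leq_ltn_trans _ zn).
have n0R : (0 : R) < n%:R by rewrite ltr0n (leq_ltn_trans _ zn).
have k0R : (0 : R) < k%:R by rewrite ltr0n.
pose C j := [pred x | (x \in Popt) && (f x == j)].
pose bad := [pred x | x \notin Popt].
pose full s := [forall j : 'I_k, (z' < count (C j) s)%N].
pose clean s := (count bad s <= z')%N.
have cbad : #|bad| = z.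
  have -> : #|bad| = #|[predC Popt]| by apply: eq_card.
  apply/eqP; rewrite -(eqn_add2l #|Popt|) cardC card_ord cPopt.
  by rewrite subnK // ltnW.
have clean_prob : 1 - eta <= Esample (R := R) m (fun s => (clean s)%:R).
  have := Esample_markov R n0 m bad z'; rewrite cbad card_ord zE.
  (* The expected number of sampled outliers is [eta] times the value that [z'] rounds down. *)
  rewrite (_ : _ * (_ / n%:R) = eta * (1 / eta * (e2 / k%:R) * m%:R)); last first.
    by field; rewrite !gt_eqF.
  rewrite (eq_Esample (F := fun s => (z' < count bad s)%N%:R)
    (G := fun s => 1 + -1 * (clean s)%:R)); last first.
    by move=> s _; rewrite /clean; case: leqP;
       rewrite /= ?mulr1 ?mulr0 ?subrr ?addr0.
  rewrite EsampleD Esample_cst // EsampleZ => markov.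
  suff : eta * (1 / eta * (e2 / k%:R) * m%:R) / z'.+1%:R <= eta.
    by move/(le_trans markov); rewrite mulN1r !lerBlDr addrC.
  by rewrite ler_pdivrMr ?ltr0n // -[z'.+1%:R]natr1 ler_wpM2l
    ?(ltW Yz) ?(ltW eta0).
have cluster_prob j :
    Esample (R := R) m (fun s => (count (C j) s <= z')%N%:R) <= eta / (2 * k%:R).
  pose mu : R := m%:R * (#|C j|%:R / #|'I_n|%:R).
  have mu_ge : m%:R * (e1 / k%:R) <= mu.
    rewrite ler_wpM2l // card_ord ler_pdivlMr //.
    by apply: le_trans (big j) _; rewrite ler_nat subset_leq_card //;
       apply/fintype.subsetP => x; rewrite inE.
  apply: le_trans (Esample_chernoff (delta := delta) n0 d0 _) _.
    rewrite -/mu; apply: le_trans zY _.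
    (* The hypothesis on [e1 / e2] amounts to [e2 / eta < (1 - delta) * e1], which puts [z'] below
       the Chernoff threshold. *)
    apply: (@le_trans _ _ ((1 - delta) * (m%:R * (e1 / k%:R)))); last first.
      by rewrite ler_wpM2l // subr_ge0 ltW.
    have -> : (1 - delta) * (m%:R * (e1 / k%:R)) = (1 - delta) * e1 / k%:R * m%:R.
      by ring.
    rewrite ler_wpM2r // mulrA ler_wpM2r ?invr_ge0 ?(ltW k0R) //.
    rewrite mul1r mulrC ler_pdivrMr //.
    have : 1 / (eta * (1 - delta)) * (eta * (1 - delta)) * e2
           <= e1 / e2 * (eta * (1 - delta)) * e2.
      by rewrite ler_wpM2r ?(ltW e2_0) // ler_wpM2r ?(ltW ratio) //
         ltW // mulr_gt0 ?subr_gt0.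
    rewrite divfK; last by rewrite mulf_neq0 ?gt_eqF // subr_gt0.
    rewrite mul1r [e1 / e2 * _]mulrAC divfK ?gt_eqF //; lra.
  rewrite -/mu.
  have q0 : 0 < 2 * k%:R / eta by rewrite divr_gt0 // mulr_gt0.
  have -> : eta / (2 * k%:R) = expR (- ln (2 * k%:R / eta)).
    by rewrite expRN lnK ?posrE // invf_div.
  rewrite ler_expR lerN2.
  apply: (@le_trans _ _ (delta ^+ 2 * (m%:R * (e1 / k%:R)) / 3)); last first.
    by rewrite ler_wpM2r ?invr_ge0 // ler_wpM2l // sqr_ge0.
  have a0 : 0 <= delta ^+ 2 * (e1 / k%:R) / 3.
    by rewrite !mulr_ge0 ?invr_ge0 ?sqr_ge0 ?ltW.
  (* This factor turns the lower bound on the sample size into exactly [ln (2 * k / eta)]. *)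
  have := ler_wpM2l a0 Xm.
  rewrite [leLHS](_ : _ = ln (2 * k%:R / eta)); last first.
    by field; rewrite ?gt_eqF.
  by congr (_ <= _); ring.
have full_prob : 1 - eta / 2 <= Esample (R := R) m (fun s => (full s)%:R).
  (* Union bound over the [k] clusters: a sample that is not full misses the quota of some
     cluster. *)
  have : 1 <= Esample (R := R) m
      (fun s => (full s)%:R + \sum_j (count (C j) s <= z')%N%:R).
    rewrite -[leLHS](Esample_cst n0 m); apply: le_Esample => s _.
    rewrite -natr_sum -natrD ler1n.
    case fs : (full s) => //.
    move/negbT: fs; rewrite negb_forall => /existsP[j]; rewrite -leqNgt => cj.
    by rewrite (bigD1 j) //= cj.
  rewrite EsampleD Esample_sum.
  have : \sum_j Esample (R := R) m (fun s => (count (C j) s <= z')%N%:R)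
      <= \sum_(j < k) eta / (2 * k%:R) by apply: ler_sum => j _.
  rewrite sumr_const card_ord -[_ *+ k]mulr_natr.
  rewrite (_ : eta / (2 * k%:R) * k%:R = eta / 2); last by field; rewrite gt_eqF.
  lra.
have assoc := @Esample_association R _ n0 bad m
  (fun s => (full s)%:R) (fun s => (clean s)%:R).
apply: (@le_trans _ _ ((1 - eta / 2) * (1 - eta))).
  by rewrite expr2 ler_wpM2r ?subr_ge0 ?ltW //; lra.
apply: (@le_trans _ _ (Esample m (fun s => (full s)%:R) *
    Esample m (fun s => (clean s)%:R))).
  by rewrite ler_pM //; lra.
apply: le_trans (assoc _ _) _.
(* A bad [y] belongs to no cluster, so replacing it by [x] lowers no cluster count. *)
- move=> s x y t /= /negbNE bx by_; rewrite ler_nat.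
  case fy : (full (s ++ y :: t)) => //; rewrite lt0b.
  move/forallP: fy => fy; apply/forallP => j; apply: leq_trans (fy j) _.
  by rewrite !count_cat /= (negbTE by_) leq_add2l leq_addl.
- move=> s x y t /= bxy; rewrite ler_nat.
  have bad_le : (count bad (s ++ x :: t) <= count bad (s ++ y :: t))%N.
    rewrite !count_cat /= leq_add2l leq_add2r.
    by move: bxy; case: (x \in Popt); case: (y \in Popt).
  case cy : (clean (s ++ y :: t)) => //; rewrite lt0b.
  exact: leq_trans bad_le cy.
(* Back to counting: the product of the two indicators is at most the indicator of success. *)
rewrite Esample_ffun card_ord ler_wpM2r ?invr_ge0 //.
rewrite -sum1_card natr_sum big_mkcond [leRHS]big_mkcond /=.
apply: ler_sum => s _.
case fs : (full (codom s)); last by rewrite mul0r; case: ifP.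
case cs : (clean (codom s)); last by rewrite mulr0; case: ifP.
rewrite mulr1 ifT // inE.
apply: (@Delta_of_good_sample R D n m k z z' P s Popt f Copt) => //.
- by apply: le_trans c1.
- exact: kc_opt_ge0.
- by move=> i /Pr[-> ].
- by move: cs; rewrite /clean count_codom.
- by move=> j; move/forallP: fs => /(_ j); rewrite count_codom.
Qed.
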